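(* Every countable sofic group can be embedded into a countable simple sofic group. In particular, there exist countable simple non-amenable sofic groups.
   Context: For $n\ge1$, $S_n$ is the symmetric group on $n$ elements and $\#_{\rm fix}\pi$ is the number of fixed points of $\pi\in S_n$. A group $\Gamma$ is sofic if for every real $0<\varepsilon<1$ and every finite subset $F\subseteq\Gamma$ there exist a natural number $n\ge 1$ and a function $\phi:\Gamma\to S_n$ such that (a) $\#_{\rm fix}(\phi(e)\phi(f)\phi(ef)^{-1})\ge(1-\varepsilon)n$ for all $e,f\in F$; (b) $\phi(1)=1$; (c) $\#_{\rm fix}\phi(e)\le\varepsilon n$ for every $1\ne e\in F$. *)

(* Defs.v *)
From mathcomp Require Import all_boot all_order all_algebra all_fingroup.
From mathcomp Require Import finmap.
From mathcomp Require Import boolp classical_sets functions cardinality reals.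

Set Implicit Arguments.
Unset Strict Implicit.
Unset Printing Implicit Defensive.

Import Order.TTheory GRing.Theory Num.Theory.

Local Open Scope classical_set_scope.
Local Open Scope ring_scope.

(* [groupType] is the library's structure of possibly infinite groups. It also
   carries a choice structure; every type has one by [boolp.gen_choiceMixin],
   so this restricts nothing. *)

Definition num_fix (n : nat) (s : 'S_n) : nat := #|[pred i | s i == i]|.

(* In ['S_n] the product [s * t] applies [s] first. The opposite convention
   gives the same notion of soficity: exchange [phi] with
   [fun g => (phi g)^-1], since a permutation and its inverse have the same
   fixed points. *)
Definition sofic (R : realType) (G : groupType) : Prop :=
  forall (eps : R) (F : {fset G}), 0 < eps -> eps < 1 ->
  exists (n : nat) (phi : G -> 'S_n),
    [/\ (1 <= n)%N,
        forall e f : G, e \in F -> f \in F ->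
          (1 - eps) * n%:R
            <= (num_fix (phi e * phi f * (phi (e * f))^-1)%g)%:R,
        phi 1%g = 1%g
      & forall e : G, e \in F -> e <> 1%g ->
          (num_fix (phi e))%:R <= eps * n%:R].

Definition normal_subgroup (G : groupType) (N : set G) : Prop :=
  [/\ N 1%g,
      forall x y, N x -> N y -> N (x * y)%g,
      forall x, N x -> N (x^-1)%g
    & forall x g, N x -> N (x ^ g)%g].

Definition simple_group (G : groupType) : Prop :=
  (exists g : G, g <> 1%g) /\
  forall N : set G, normal_subgroup N -> N = [set 1%g] \/ N = [set: G].

(* Amenability of a discrete group in the sense of von Neumann: there is a
   finitely additive left-invariant probability measure on all subsets. *)
Definition amenable (R : realType) (G : groupType) : Prop :=
  exists mu : set G -> R,
    [/\ forall A, 0 <= mu A,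
        mu [set: G] = 1,
        forall A B, A `&` B = set0 -> mu (A `|` B) = mu A + mu B
      & forall (g : G) A, mu [set (g * x)%g | x in A] = mu A].

(* Main.v *)
Require Import Defs.
From HB Require Import structures.
From mathcomp Require Import all_boot all_order all_algebra all_fingroup.
From mathcomp Require Import finmap.
From mathcomp Require Import boolp classical_sets functions cardinality reals.
From mathcomp Require Import filter zify ring lra.

(* A countable sofic group embeds into a metric ultraproduct U of finite
   symmetric groups of unbounded degree. If a permutation p of an n-element set
   moves at least n / M points, then every permutation is, up to 4 points, a
   product of 6M factors of the form (p^-1)^g * p^h: a product t of disjoint
   transpositions exchanging points of a set A disjoint from p(A) satisfies
   t * (t^-1)^p = (p^-1)^(t^-1) * p, every product of an even number, bounded
   by n / (3M), of disjoint transpositions is conjugate to such an element, and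
   every permutation is a product of two involutions. Hence every y in U is a
   product of conjugates of x and x^-1 whenever x <> 1. Closing the
   embedded group under a choice of such conjugators gives a countable simple
   subgroup of U, and it is sofic because all subgroups of U are: tensor powers
   of permutations push the proportion of fixed points of a non-trivial element
   to 0. Applied to SL(2, Z), which is residually finite and not amenable, this
   gives the non-amenable example. *)

Set Implicit Arguments.
Unset Strict Implicit.
Unset Printing Implicit Defensive.

Import Order.TTheory GRing.Theory Num.Theory.

(** Each factor pairs a conjugate of [x^-1] with one of [x], the shape in which [swaps_conj]
    delivers elements of the normal closure of [x]. *)
Definition conj_prod (G : groupType) (x : G) (w : seq (G * G)) : G :=
  (\prod_(c <- w) (x^-1 ^ c.1 * x ^ c.2))%g.

(** * Products of conjugates in finite symmetric groups *)

Section FinitePermutations.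
Import fintype finset.
Local Open Scope group_scope.
Variable T : finType.
Implicit Types (s t p : {perm T}) (L : seq (T * T)).

Definition moved s : {set T} := [set x | s x != x].

Lemma card_moved1 : #|moved 1| = 0.
Proof. by apply: eq_card0 => x; rewrite !inE perm1 eqxx. Qed.

Lemma movedV s : moved s^-1 = moved s.
Proof. by apply/setP => x; rewrite !inE -(inj_eq (@perm_inj _ s)) permKV eq_sym. Qed.

Lemma moved_mul s t : moved (s * t) \subset moved s :|: moved t.
Proof.
apply/subsetP => x; rewrite !inE permM; apply: contraNT.
by rewrite negb_or !negbK => /andP[/eqP -> ].
Qed.

Lemma card_moved_mul s t : #|moved (s * t)| <= #|moved s| + #|moved t|.
Proof. by apply: leq_trans (leq_card_setU _ _); exact: subset_leq_card (moved_mul s t). Qed.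

Lemma card_movedJ s t : #|moved (s ^ t)| = #|moved s|.
Proof.
rewrite -(card_imset (moved s) (@perm_inj _ t)); apply: eq_card => x.
rewrite inE -[x](permKV t) permJ (inj_eq (@perm_inj _ t)).
by rewrite (mem_imset _ _ (@perm_inj _ t)) inE.
Qed.

Lemma card_moved_tperm x y : #|moved (tperm x y)| <= 2.
Proof.
apply: leq_trans (_ : #|[set x; y]| <= 2); last by rewrite cards2; case: (_ != _).
apply/subset_leq_card/subsetP => z; rewrite !inE.
by case: tpermP => [->|->|_ _]; rewrite ?eqxx ?orbT.
Qed.

(* On the cycle through [r], the first factor is the reflection
   [s^k r |-> s^-k r]. *)
Lemma perm_two_involutions s :
  exists a b : {perm T}, [/\ a * a = 1, b * b = 1 & s = a * b].
Proof.
pose r x := froot s x; pose k x := s ^+ findex s (r x) x.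
have ks x : k x \in <[s]> by exact: mem_cycle.
have kE x : k x (r x) = x.
  by rewrite permX iter_findex // fconnect_sym ?connect_root //; exact: perm_inj.
have rE x g : g \in <[s]> -> r (g x) = r x.
  move=> /cycleP[i ->]; apply/esym/eqP.
  by rewrite (root_connect (fconnect_sym (@perm_inj _ s))) permX fconnect_iter.
have rr x : r (r x) = r x by exact: (root_root (fconnect_sym (@perm_inj _ s))).
(* The exponent in [k] matters only modulo the cycle length: since [<[s]>] is abelian, powers of [s]
   that agree at a point have inverses that agree there. *)
have wd (g h : {perm T}) x : g \in <[s]> -> h \in <[s]> -> g x = h x -> g^-1 x = h^-1 x.
  move=> gs hs e; apply: (@perm_inj _ (g * h)); rewrite -!permM mulKg.
  by rewrite -(centsP (cycle_abelian s) h hs g gs) mulKg.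
pose rho x := (k x)^-1 (r x).
have rhoE g x : g \in <[s]> -> rho (g (r x)) = g^-1 (r x).
  move=> gs; rewrite /rho rE // rr; apply: wd => //.
  by have := kE (g (r x)); rewrite rE // rr.
have rhoK : involutive rho.
  by move=> x; change (rho ((k x)^-1 (r x)) = x); rewrite rhoE ?groupV // invgK kE.
pose a := perm (inv_inj rhoK).
have aE x : a x = rho x by rewrite permE.
have aa : a * a = 1 by apply/permP => x; rewrite permM perm1 !aE rhoK.
exists a, (a * s); split => //; last by rewrite mulgA aa mul1g.
apply/permP => x; rewrite perm1 !permM !aE.
change (s (rho (s ((k x)^-1 (r x)))) = x); rewrite -permM rhoE.
  rewrite -permM invMg invgK -mulgA.
  by rewrite (centsP (cycle_abelian s) _ (ks x) s (cycle_id s)) mulKg kE.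
by rewrite groupM ?groupV ?cycle_id.
Qed.

Definition swaps L : {perm T} := \prod_(x <- L) tperm x.1 x.2.

(** [uniq (flat L)] says that the transpositions in [L] are proper and have disjoint supports. *)
Definition flat L : seq T := flatten [seq [:: x.1; x.2] | x <- L].

Lemma swaps_cat L L' : swaps (L ++ L') = swaps L * swaps L'.
Proof. by rewrite /swaps big_cat. Qed.

Lemma flat_cat L L' : flat (L ++ L') = flat L ++ flat L'.
Proof. by rewrite /flat map_cat flatten_cat. Qed.

Lemma size_flat L : size (flat L) = (size L).*2.
Proof. by elim: L => //= x L ->. Qed.

Lemma swaps_rev L : swaps (rev L) = (swaps L)^-1.
Proof.
elim: L => [|x L IH]; first by rewrite /swaps big_nil invg1.
by rewrite rev_cons -cats1 swaps_cat IH /swaps big_seq1 big_cons invMg tpermV.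
Qed.

Lemma swapsJ L s : swaps L ^ s = swaps [seq (s x.1, s x.2) | x <- L].
Proof.
elim: L => [|x L IH]; first by rewrite /swaps !big_nil conj1g.
by rewrite /swaps /= !big_cons conjMg tpermJ; congr (_ * _); exact: IH.
Qed.

Lemma flat_map L s : flat [seq (s x.1, s x.2) | x <- L] = [seq s x | x <- flat L].
Proof. by rewrite /flat map_flatten -!map_comp. Qed.

Lemma flat_inj : injective flat.
Proof.
elim=> [|[x y] L IH] [|[x' y'] L'] //=.
by case=> -> -> /IH ->.
Qed.

Lemma perm_flat_rev L : perm_eq (flat (rev L)) (flat L).
Proof.
elim: L => // x L IH; rewrite rev_cons -cats1 flat_cat perm_catC /=.
by rewrite !perm_cons.
Qed.

Lemma even_seq_flat (a : seq T) k : size a = k.*2 -> exists L, flat L = a.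
Proof.
elim: k a => [|k IH] [|x [|y a]] //; first by exists [::].
by move=> [] /IH[L <-]; exists ((x, y) :: L).
Qed.

(** Induction on the number of moved points: composing [s] with [tperm x (s x)] yields an involution
    that fixes [x] and [s x] and agrees with [s] elsewhere. *)
Lemma involution_swaps s : s * s = 1 -> exists2 L, s = swaps L & uniq (flat L).
Proof.
move: {2}(#|moved s|) (leqnn #|moved s|) => n.
(* The inclusion in [moved s] keeps the pair split off disjoint from the remaining ones. *)
suff: #|moved s| <= n -> s * s = 1 ->
   exists L, [/\ s = swaps L, uniq (flat L) & {subset flat L <= moved s}].
  by move=> H ? ?; case: H => // L [? ? _]; exists L.
elim: n s => [|n IH] s.
  rewrite leqn0 cards_eq0 => /eqP m0 _; exists [::]; split => //.
  apply/permP => x; rewrite /swaps big_nil perm1; apply/eqP.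
  by move/setP/(_ x): m0; rewrite !inE => /negbFE.
move=> ms ss; have [m0|[x]] := set_0Vmem (moved s).
  by apply: IH => //; rewrite m0 cards0.
rewrite inE => xs; have sK y : s (s y) = y by rewrite -permM ss perm1.
pose t := tperm x (s x) * s.
have tx : t x = x by rewrite permM tpermL sK.
have tsx : t (s x) = s x by rewrite permM tpermR.
have ty y : x != y -> s x != y -> t y = s y by move=> ? ?; rewrite permM tpermD.
have tm y : t y != y -> [/\ x != y, s x != y & s y != y].
  have [<-|xy] := eqVneq x y; first by rewrite tx eqxx.
  have [<-|sxy] := eqVneq (s x) y; first by rewrite tsx eqxx.
  by rewrite ty.
have [] := IH t.
- rewrite -ltnS (leq_trans _ ms) //; apply: proper_card; apply/properP; split.
    by apply/subsetP => y; rewrite !inE => /tm[].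
  by exists x; rewrite !inE // tx eqxx.
- apply/permP => y; rewrite permM perm1.
  have [/eqP tyy|/tm[xy sxy sy]] := boolP (t y == y); first by rewrite !tyy.
  rewrite (ty y) // ty ?sK //; last by rewrite (inj_eq perm_inj).
  by apply: contra sxy => /eqP ->; rewrite sK.
move=> L [tL uL Lm]; exists ((x, s x) :: L); split.
- by rewrite /swaps big_cons -/(swaps L) -tL mulgA tperm2 mul1g.
- rewrite /= uL inE eq_sym negb_or xs andbT /=; apply/andP; split; apply/negP => /Lm.
    by rewrite inE tx eqxx.
  by rewrite inE tsx eqxx.
- move=> y; rewrite /= !inE => /or3P[/eqP ->|/eqP ->|/Lm] //.
    by rewrite (inj_eq perm_inj).
  by rewrite inE => /tm[].
Qed.

(** Used to conjugate one list of disjoint transpositions to another. Each induction step corrects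
    the image of the head by a transposition that fixes the images of the tail. *)
Lemma perm_extension (a b : seq T) : uniq a -> uniq b -> size a = size b ->
  exists s, [seq s x | x <- a] = b.
Proof.
elim: a b => [|x a IH] [|y b] //=; first by exists 1.
move=> /andP[xa ua] /andP[yb ub] [/(IH _ ua ub)[s sab]].
exists (s * tperm (s x) y); rewrite permM tpermL; congr (_ :: _).
rewrite -[RHS]sab; apply/eq_in_map => z za; rewrite permM tpermD //.
  by rewrite (inj_eq perm_inj); apply: contraNneq xa => ->.
by apply: contraNneq yb => ->; rewrite -sab map_f.
Qed.

(** Greedy choice: [k] chosen points exclude at most [3 * k] candidates [x], namely those in [a],
    those in [p(a)], and those with [p x] in [a]. *)
Lemma disjoint_from_image p k : 3 * k <= #|moved p| ->
  exists2 a : seq T, size a = k & uniq (a ++ map p a).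
Proof.
elim: k => [|k IH] km; first by exists [::].
have [|a ak ua] := IH; first by lia.
pose B := [set x in a] :|: [set x in map p a] :|: [set x in map (p^-1)%g a].
have size_set (c : seq T) : #|[set x in c]| <= size c by rewrite cardsE card_size.
have Bk : #|B| <= 3 * k.
  apply: leq_trans (leq_card_setU _ _) _.
  have := (leq_card_setU [set x in a] [set x in map p a]).1.
  have := size_set a; have := size_set (map p a); have := size_set (map (p^-1)%g a).
  rewrite !size_map ak; lia.
have /subsetPn[x xp] : ~~ (moved p \subset B).
  by apply/negP => /subset_leq_card; lia.
rewrite !inE !negb_or in xp * => /andP[/andP[xa xpa] xVa].
exists (x :: a); first by rewrite /= ak.
have pxa : p x \notin a.
  by apply: contra xVa => /(map_f (p^-1)%g); rewrite permK.
have pxpa : p x \notin map p a by rewrite (mem_map perm_inj).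
rewrite /= mem_cat !inE negb_or xa (negbTE xpa) orbF eq_sym xp /=.
by rewrite -cat1s uniq_catCA cat1s /= mem_cat negb_or pxa pxpa.
Qed.

Lemma swaps_conj p L : ~~ odd (size L) -> uniq (flat L) ->
  3 * size L <= #|moved p| -> exists c, swaps L = p^-1 ^ c.1 * p ^ c.2.
Proof.
move=> evL uL mL; pose k := (size L)./2.
have Lk : size L = k.*2 by rewrite -[LHS]odd_double_half (negbTE evL).
have [a ak ua] := disjoint_from_image mL.
have [A Aa] : exists A, flat A = a by apply: (@even_seq_flat _ k); rewrite ak.
have Ak : size A = k by apply/double_inj; rewrite -size_flat Aa ak.
(* The reversal makes the second half the inverse of the first conjugated by [p], so [swaps L'] is
   [t * (t^-1) ^ p] for [t = swaps A]. *)
pose L' := A ++ [seq (p x.1, p x.2) | x <- rev A].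
have [g gL] : exists g : {perm T}, [seq g x | x <- flat L'] = flat L.
  apply: perm_extension => //.
    rewrite flat_cat flat_map (perm_uniq (_ : perm_eq _ (a ++ map p a))) // Aa.
    by rewrite perm_cat2l perm_map // -Aa perm_flat_rev.
  by rewrite !size_flat size_cat size_map size_rev Ak Lk addnn.
have {gL} -> : L = [seq (g x.1, g x.2) | x <- L'] by apply: flat_inj; rewrite flat_map gL.
rewrite -swapsJ swaps_cat -swapsJ swaps_rev; set t := swaps A.
exists (t^-1 * g, g); rewrite /= conjgM -conjMg; congr (_ ^ _).
by rewrite !conjgE invgK !mulgA.
Qed.

(** [L] is cut into [K] blocks of at most [2q] transpositions, each of even length and possibly
    empty, so the number of factors is the same for all such [L]. *)
Lemma swaps_conj_prod p L q K : ~~ odd (size L) -> uniq (flat L) ->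
  6 * q <= #|moved p| -> size L <= K * q.*2 ->
  exists2 w, size w = K & swaps L = conj_prod p w.
Proof.
move=> evL uL mq; elim: K L evL uL => [|K IH] L evL uL LK.
  by case: L LK {evL uL} => // _; exists [::]; rewrite // /swaps /conj_prod !big_nil.
have evt : ~~ odd (size (take q.*2 L)).
  by rewrite size_take; case: ltnP => // _; rewrite odd_double.
move: evL uL; rewrite -{1 2}(cat_take_drop q.*2 L) size_cat oddD (negbTE evt) /=.
rewrite flat_cat cat_uniq => evd /and3P[ut _ ud].
have [|w wK wE] := IH _ evd ud; first by rewrite size_drop; lia.
have [|c cE] := swaps_conj evt ut (p := p).
  by rewrite size_take; case: ltnP; lia.
exists (c :: w); first by rewrite /= wK.
by rewrite -{1}(cat_take_drop q.*2 L) swaps_cat cE wE /conj_prod big_cons.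
Qed.

(* The parity obstruction costs at most one transposition for each of the two
   involutions, hence the bound 4. *)
Lemma approx_conj_prod p s M : #|T| <= M * #|moved p| -> 12 * M <= #|T| ->
  exists2 w, size w = (6 * M)%N & #|moved (s * (conj_prod p w)^-1)| <= 4.
Proof.
move=> Mm M12; have [a [b [/involution_swaps[A aA uA] /involution_swaps[B bB uB] sab]]] :=
  perm_two_involutions s.
have half (L : seq (T * T)) : uniq (flat L) -> exists t w,
    [/\ size w = (3 * M)%N, swaps L = t * conj_prod p w & #|moved t| <= 2].
  move=> uL; have sL : (size L).*2 <= #|T|.
    by rewrite -size_flat -(card_uniqP uL) max_card.
  pose q := #|moved p| %/ 6.
  have mq : 6 * q <= #|moved p| by rewrite mulnC leq_trunc_div.
  (* For positive [M] the hypotheses force at least 12 moved points, so [q >= 2] and the rounding in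
     [q] is absorbed: [#|T| / 2 <= M * (6 * q + 5) / 2 <= 6 * M * q]. *)
  have LM : size L <= 3 * M * q.*2.
    have := ltn_ceil #|moved p| (isT : 0 < 6); rewrite -/q => mq1.
    case: M Mm M12 => [|M] Mm M12; first by lia.
    have : 12 <= #|moved p| by rewrite -(leq_pmul2l (ltn0Sn M)) mulnC; lia.
    move=> m12; have q2 : 2 <= q by lia.
    have : M.+1 * #|moved p| <= M.+1 * (q * 6 + 5)%N by rewrite leq_mul2l /=; lia.
    nia.
  have [oL|evL] := boolP (odd (size L)); last first.
    have [w wM ->] := swaps_conj_prod evL uL mq LM.
    by exists 1, w; rewrite mul1g card_moved1.
  case: L oL uL LM {sL} => // x L /= oL /and3P[_ _ uL] LM.
  have [w wM wE] := swaps_conj_prod oL uL mq (ltnW LM).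
  by exists (tperm x.1 x.2), w; rewrite /swaps big_cons -wE card_moved_tperm.
have [t1 [w1 [w1M E1 m1]]] := half A uA; have [t2 [w2 [w2M E2 m2]]] := half B uB.
exists (w1 ++ w2); first by rewrite size_cat w1M w2M; lia.
rewrite sab aA bB E1 E2 /conj_prod big_cat -!/(conj_prod _ _) /=.
set c1 := conj_prod _ w1; set c2 := conj_prod _ w2.
(* The two parity defects are collected on the left; conjugating [t2] does not change how many
   points it moves. *)
have -> : t1 * c1 * (t2 * c2) * (c1 * c2)^-1 = t1 * t2 ^ c1^-1.
  by rewrite conjgE invgK invMg !mulgA mulgK.
by rewrite (leq_trans (card_moved_mul _ _)) // card_movedJ; lia.
Qed.

End FinitePermutations.

Local Open Scope classical_set_scope.
Local Open Scope group_scope.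

(** * Metric ultraproducts *)

Section QuotientGroup.
Local Open Scope quotient_scope.
Variables (G : groupType) (N : set G) (nN : normal_subgroup N).
Implicit Types x y : G.

Let N1 : N 1. Proof. by case: nN. Qed.
Let NM x y : N x -> N y -> N (x * y). Proof. by case: nN => _ NM _ _; exact: NM. Qed.
Let NV x : N x -> N x^-1. Proof. by case: nN => _ _ NV _; exact: NV. Qed.
Let NJ x y : N x -> N (x ^ y). Proof. by case: nN => _ _ _; apply. Qed.

Definition congr_mod x y := `[< N (x * y^-1) >].

Lemma congr_mod_equiv : equiv_class_of congr_mod.
Proof.
split=> [x|x y|y x z]; first by apply/asboolP; rewrite mulgV.
- by apply: asbool_equiv_eq; split=> /NV; rewrite invMg invgK.
- move=> /asboolP xy /asboolP yz; apply/asboolP.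
  by have := NM xy yz; rewrite mulgA mulgVK.
Qed.

Canonical congr_mod_rel := EquivRelPack congr_mod_equiv.

Definition quotient_group := {eq_quot congr_mod_rel}.
HB.instance Definition _ := Choice.on quotient_group.
HB.instance Definition _ := EqQuotient.on quotient_group.

Lemma pi_quotP x y : \pi_quotient_group x = \pi_quotient_group y <-> N (x * y^-1).
Proof. by split=> [/eqmodP/asboolP|H] //; apply/eqmodP/asboolP. Qed.

Notation repr := generic_quotient.repr.
Notation pi := (\pi_quotient_group).

Let mul (a b : quotient_group) : quotient_group := pi (repr a * repr b).
Let inv (a : quotient_group) : quotient_group := pi (repr a)^-1.
Let one : quotient_group := pi 1.

Let Nrepr x : N (repr (pi x) * x^-1).
Proof. by apply/pi_quotP; rewrite reprK. Qed.

Let mulE x y : mul (pi x) (pi y) = pi (x * y).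
Proof.
apply/pi_quotP; rewrite invMg.
have := NM (NJ (repr (pi x))^-1 (Nrepr y)) (Nrepr x).
by rewrite conjgE invgK !mulgA mulgVK.
Qed.

Let invE x : inv (pi x) = pi x^-1.
Proof.
apply/pi_quotP; have := NJ (repr (pi x)) (NV (Nrepr x)).
by rewrite conjgE invMg !invgK !mulgA mulgVK.
Qed.

Let piE (a : quotient_group) : exists x, a = pi x.
Proof. by exists (repr a); rewrite reprK. Qed.

Let mulA : associative mul.
Proof.
move=> a b c; have [x ->] := piE a; have [y ->] := piE b; have [z ->] := piE c.
by rewrite (mulE y z) (mulE x y) !mulE mulgA.
Qed.
Let mul1 : left_id one mul.
Proof. by move=> a; rewrite -[a]reprK mulE mul1g. Qed.
Let mulr1 : right_id one mul.
Proof. by move=> a; rewrite -[a]reprK mulE mulg1. Qed.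
Let mulV : left_inverse one inv mul.
Proof. by move=> a; rewrite -[a]reprK invE mulE mulVg. Qed.
Let mulrV : right_inverse one inv mul.
Proof. by move=> a; rewrite -[a]reprK invE mulE mulgV. Qed.

HB.instance Definition _ :=
  isGroup.Build quotient_group mulA mul1 mulr1 mulV mulrV.

Definition quot_map x : quotient_group := pi x.

Lemma quot_mapM : {morph quot_map : x y / x * y}.
Proof. by move=> x y; exact/esym/mulE. Qed.

HB.instance Definition _ := isMultiplicative.Build G quotient_group quot_map quot_mapM.

Lemma quot_mapP x y : quot_map x = quot_map y <-> N (x * y^-1).
Proof. exact: pi_quotP. Qed.

Lemma quot_map1 : quot_map 1 = 1.
Proof. by []. Qed.

HB.instance Definition _ :=
  Multiplicative_isUMagmaMorphism.Build G quotient_group quot_map quot_map1.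

Lemma quot_map_surj (a : quotient_group) : exists x, quot_map x = a.
Proof. by exists (repr a); rewrite /quot_map reprK. Qed.

End QuotientGroup.

Section ProductGroup.
Variables (I : Type) (G : I -> groupType).

Definition prod_group := forall i, G i.

HB.instance Definition _ := gen_eqMixin prod_group.
HB.instance Definition _ := gen_choiceMixin prod_group.

Let mul (x y : prod_group) : prod_group := fun i => x i * y i.
Let inv (x : prod_group) : prod_group := fun i => (x i)^-1.
Let one : prod_group := fun i => 1.

Let mulA : associative mul.
Proof. by move=> x y z; apply: functional_extensionality_dep => i; exact: mulgA. Qed.
Let mul1 : left_id one mul.
Proof. by move=> x; apply: functional_extensionality_dep => i; exact: mul1g. Qed.
Let mulr1 : right_id one mul.
Proof. by move=> x; apply: functional_extensionality_dep => i; exact: mulg1. Qed.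
Let mulV : left_inverse one inv mul.
Proof. by move=> x; apply: functional_extensionality_dep => i; exact: mulVg. Qed.
Let mulrV : right_inverse one inv mul.
Proof. by move=> x; apply: functional_extensionality_dep => i; exact: mulgV. Qed.

HB.instance Definition _ :=
  isGroup.Build prod_group mulA mul1 mulr1 mulV mulrV.

Definition coord i (x : prod_group) : G i := x i.

Lemma coordM i : {morph coord i : x y / x * y}.
Proof. by []. Qed.

Lemma coord1 i : coord i 1 = 1.
Proof. by []. Qed.

HB.instance Definition _ i := isMultiplicative.Build prod_group (G i) (coord i) (@coordM i).
HB.instance Definition _ i :=
  Multiplicative_isUMagmaMorphism.Build prod_group (G i) (coord i) (coord1 i).

End ProductGroup.

Lemma conj_prod_morph (G H : groupType) (f : UMagmaMorphism.type G H) x w :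
  f (conj_prod x w) = conj_prod (f x) [seq (f c.1, f c.2) | c <- w].
Proof.
rewrite /conj_prod gmulf_prod big_map; apply: eq_bigr => c _ /=.
by rewrite gmulfM !gmulfJ gmulfV.
Qed.

Lemma conj_prod_normal (G : groupType) (N : set G) x w :
  normal_subgroup N -> N x -> N (conj_prod x w).
Proof.
case=> N1 NM NV NJ Nx; rewrite /conj_prod; elim: w => [|c w IH]; first by rewrite big_nil.
by rewrite big_cons; apply: (NM) => //; apply: NM; apply: NJ => //; apply: NV.
Qed.

Lemma simple_conj_prod (G : groupType) : (exists x : G, x <> 1) ->
  (forall x y : G, x <> 1 -> exists w, y = conj_prod x w) -> simple_group G.
Proof.
move=> nt gen; split=> // N nN.
have [[x [Nx x1]]|triv] := pselect (exists x, N x /\ x <> 1); [right|left].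
  apply/seteqP; split=> // y _; have [w ->] := gen x y x1.
  exact: conj_prod_normal.
apply/seteqP; split=> [x Nx|x ->]; last by case: nN.
by apply: contrapT => x1; apply: triv; exists x.
Qed.

(** The witness is the cyclic shift along an enumeration of [T]. *)
Lemma fixed_point_free_perm (T : finType) : (2 <= #|T|)%N ->
  exists s : {perm T}, #|moved s| = #|T|.
Proof.
move=> T2; pose f (x : T) := enum_val (ordS (enum_rank x)).
have f_inj : injective f.
  by move=> x y /enum_val_inj /ordS_inj /enum_rank_inj.
exists (perm f_inj); apply: eq_card => x; rewrite !inE permE /f.
apply/eqP => /(congr1 (fun y => val (enum_rank y))); rewrite enum_valK /=.
have := ltn_ord (enum_rank x); move: (val _) => k.
rewrite leq_eqVlt => /predU1P[kn|kn]; last by rewrite modn_small //; lia.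
rewrite {1}kn modnn => k0; move: T2; rewrite -kn; lia.
Qed.

Section Ultraproduct.
Variables (I : Type) (om : set_system I) (T : I -> finType).
Context {omU : UltraFilter om}.
Hypothesis T_large : forall m, om [set i | (m <= #|T i|)%N].

Local Notation P := (prod_group (fun i => {perm T i})).

(* The sequences of normalised Hamming length tending to [0] along [om]. *)
Definition null_seq : set P :=
  [set x | forall m, om [set i | (m * #|moved (x i)| <= #|T i|)%N]].

Lemma null_seq_normal : normal_subgroup null_seq.
Proof.
split=> [m|x y Nx Ny m|x Nx m|x g Nx m].
- by apply: filterS filterT => i _ /=; rewrite card_moved1 muln0.
- have Nx2 := Nx (2 * m)%N; have Ny2 := Ny (2 * m)%N.
  apply: filterS2 Nx2 Ny2 => i /= Nxi Nyi.
  have := leq_mul (leqnn m) (card_moved_mul (x i) (y i)); rewrite -[x i * y i]/((x * y) i); lia.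
- by apply: filterS (Nx m) => i /=; rewrite movedV.
- by apply: filterS (Nx m) => i /=; rewrite card_movedJ.
Qed.

Definition ultraproduct := quotient_group null_seq_normal.
HB.instance Definition _ := Group.on ultraproduct.

Definition ultra_class : P -> ultraproduct := quot_map null_seq_normal.
HB.instance Definition _ := UMagmaMorphism.on ultra_class.

(** The ultrafilter property turns the failure of a limit into a lower bound valid on a large set of
    indices. *)
Lemma not_null_seq (x : P) : ~ null_seq x ->
  exists m, om [set i | (#|T i| <= m * #|moved (x i)|)%N].
Proof.
move=> /existsNP[m Nm]; exists m.
have [//|] := in_ultra_setVsetC [set i | (m * #|moved (x i)| <= #|T i|)%N] omU.
by apply: filterS => i /= /negP; rewrite -ltnNge => /ltnW.
Qed.

Lemma ultra_class_eq1 (x : P) : ultra_class x = 1 <-> null_seq x.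
Proof.
rewrite -(quot_map1 null_seq_normal).
by split=> [/quot_mapP|Nx]; [|apply/quot_mapP]; rewrite invg1 mulg1.
Qed.

Lemma ultra_class_surj (a : ultraproduct) : exists x, ultra_class x = a.
Proof. exact: quot_map_surj. Qed.

Lemma ultraproduct_nontrivial : exists x : ultraproduct, x <> 1.
Proof.
have s_ex i : exists s : {perm T i}, (2 <= #|T i|)%N -> #|moved s| = #|T i|.
  have [/fixed_point_free_perm[s sT]|_] := leqP 2 #|T i|; last by exists 1.
  by exists s.
exists (ultra_class (fun i => projT1 (cid (s_ex i)))) => /ultra_class_eq1 /(_ 2) N2.
have [i [/= T2]] := filter_ex (filterI (T_large 2) N2).
by case: (cid _) => s /= -> //; lia.
Qed.

(** In almost every coordinate there is an approximating word whose length [6 * m] does not depend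
    on the coordinate, so these words assemble into one word over the product. The error of 4 points
    is null because the degrees tend to infinity. *)
Lemma ultraproduct_conj_prod (a b : ultraproduct) : a <> 1 -> exists w, b = conj_prod a w.
Proof.
have [x <-] := ultra_class_surj a; have [y <-] := ultra_class_surj b.
move=> /ultra_class_eq1/not_null_seq[m xm].
have w_ex i : exists w : seq ({perm T i} * {perm T i}),
    (#|T i| <= m * #|moved (x i)|)%N -> (12 * m <= #|T i|)%N ->
    size w = (6 * m)%N /\ (#|moved (y i * (conj_prod (x i) w)^-1)| <= 4)%N.
  have [Tm|?] := leqP #|T i| (m * #|moved (x i)|)%N; last by exists [::].
  have [T12|?] := leqP (12 * m) #|T i|; last by exists [::].
  by have [w wm w4] := approx_conj_prod (y i) Tm T12; exists w.
pose w i := projT1 (cid (w_ex i)).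
pose W : seq (P * P) := [seq (fun i => (nth (1, 1) (w i) j).1, fun i => (nth (1, 1) (w i) j).2)
                 | j <- iota 0 (6 * m)].
exists [seq (ultra_class c.1, ultra_class c.2) | c <- W]; rewrite -conj_prod_morph.
apply/quot_mapP => k.
apply: filterS (filterI xm (filterI (T_large (12 * m)) (T_large (k * 4)))) => i /= [h1 [h2 h3]].
have [sw mw] : size (w i) = (6 * m)%N /\ (#|moved (y i * (conj_prod (x i) (w i))^-1)| <= 4)%N.
  by rewrite /w; case: (cid _) => v /= /(_ h1 h2).
suff -> : (y * (conj_prod x W)^-1) i = y i * (conj_prod (x i) (w i))^-1.
  by rewrite (leq_trans _ h3) // leq_mul2l mw orbT.
rewrite -[LHS]/(coord i _) gmulfM gmulfV conj_prod_morph; congr (_ * (conj_prod _ _)^-1).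
rewrite -map_comp -[RHS](mkseq_nth (1, 1)) sw; apply: eq_map => j /=.
by rewrite /coord; case: nth.
Qed.

End Ultraproduct.

(** * Countable simple subgroups *)

Record subgroup (G : groupType) (S : {pred G}) (SG : group_closed S) :=
  Subgroup { subgroup_val : G; subgroup_valP : subgroup_val \in S }.

Section Subgroup.
Variables (G : groupType) (S : {pred G}) (SG : group_closed S).

HB.instance Definition _ := [isSub for @subgroup_val G S SG].
HB.instance Definition _ := [Choice of subgroup SG by <:].
HB.instance Definition _ := SubChoice_isSubGroup.Build G S (subgroup SG) SG.

End Subgroup.

Section CountableSimpleSubgroup.
Variables (U : groupType) (c : nat -> U) (w : U -> U -> seq (U * U)).
Hypothesis wP : forall x y, x <> 1 -> y = conj_prod x (w x y).
Hypothesis c0 : c 0 <> 1.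

(* Elements of the least subgroup containing the [c n] and closed under the
   witnesses [w x y], written as terms. *)
Fixpoint term_val (t : GenTree.tree nat) : U :=
  match t with
  | GenTree.Leaf n => c n
  | GenTree.Node 0 [:: t1; t2] => term_val t1 * (term_val t2)^-1
  | GenTree.Node k.+1 [:: t1; t2] =>
      nth 1 (flatten [seq [:: x.1; x.2] | x <- w (term_val t1) (term_val t2)]) k
  | _ => 1
  end.

Definition term_vals : {pred U} := [pred x | `[< range term_val x >]].

Lemma term_valsP x : reflect (range term_val x) (x \in term_vals).
Proof. by rewrite inE; exact: asboolP. Qed.

Lemma term_vals_group : group_closed term_vals.
Proof.
split; first by apply/term_valsP; exists (GenTree.Node 0 [::]).
move=> _ _ /term_valsP[t1 _ <-] /term_valsP[t2 _ <-]; apply/term_valsP.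
by exists (GenTree.Node 0 [:: t1; t2]).
Qed.

Lemma term_vals_wit x y z : x \in term_vals -> y \in term_vals -> z \in w x y ->
  z.1 \in term_vals /\ z.2 \in term_vals.
Proof.
move=> /term_valsP[t1 _ <-] /term_valsP[t2 _ <-] zw.
suff H u : u \in flatten [seq [:: x.1; x.2] | x <- w (term_val t1) (term_val t2)] ->
    u \in term_vals.
  by split; apply: H; apply/flatten_mapP; exists z; rewrite // !inE eqxx ?orbT.
(* The label 0 stands for division, so positions in the witness are shifted by one. *)
move=> uw; apply/term_valsP; exists (GenTree.Node (index u
  (flatten [seq [:: x.1; x.2] | x <- w (term_val t1) (term_val t2)])).+1 [:: t1; t2]) => //=.
by rewrite nth_index.
Qed.

Definition term_group := subgroup term_vals_group.
HB.instance Definition _ := SubGroup.on term_group.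

(** Choosing a term for every element injects the group into the countable type of trees. *)
Lemma term_group_countable : countable [set: term_group].
Proof.
have H (h : term_group) : exists t, term_val t = val h.
  by have /term_valsP[t _ th] := valP h; exists t.
apply/countable_injP; exists (fun h => choice.pickle (projT1 (cid (H h)))).
move=> h h' _ _ /(pcan_inj choice.pickleK).
by case: (cid _) => t th; case: (cid _) => t' th' /= tt'; apply: val_inj; rewrite -th -th' tt'.
Qed.

Lemma term_group_simple : simple_group term_group.
Proof.
apply: simple_conj_prod.
  have c0S : c 0 \in term_vals by apply/term_valsP; exists (GenTree.Leaf 0).
  by exists (Sub (c 0) c0S) => /(congr1 val); rewrite SubK val1.
move=> x y x1; pose lift (u : U) : term_group := insubd 1 u.
have liftK u : u \in term_vals -> val (lift u) = u by exact: insubdK.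
exists [seq (lift z.1, lift z.2) | z <- w (val x) (val y)].
apply: val_inj; rewrite conj_prod_morph -map_comp map_id_in; last first.
  by move=> z /(term_vals_wit (valP x) (valP y))[z1 z2] /=; rewrite !liftK //; case: z z1 z2.
by apply: wP => /= x1'; apply: x1; apply: val_inj; rewrite val1.
Qed.

End CountableSimpleSubgroup.

(** A Skolem hull: being a product of conjugates is witnessed by finitely many elements, so it
    survives in a countable subgroup closed under a choice of witnesses. *)
Lemma countable_simple_subgroup (U : groupType) (C : set U) :
  (exists x : U, x <> 1) ->
  (forall x y : U, x <> 1 -> exists w, y = conj_prod x w) -> countable C ->
  exists (H : groupType) (v : {multiplicative H -> U}),
    [/\ countable [set: H], simple_group H, injective v & C `<=` range v].
Proof.
move=> [u u1] gen Cc.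
have wit (x y : U) : exists w, x <> 1 -> y = conj_prod x w.
  by have [x1|/(@gen x y)[w yE]] := pselect (x = 1); [exists [::] | exists w].
pose w (x y : U) := projT1 (cid (wit x y)).
have wP (x y : U) : x <> 1 -> y = conj_prod x (w x y).
  by rewrite /w; case: (cid _).
have [c cC] : exists c : nat -> U, C `<=` range c.
  have [f finj] := countable_injP _ Cc.
  have ex n : exists x : U, forall y, C y -> f y = n -> y = x.
    have [[y [Cy <-]]|no] := pselect (exists y, C y /\ f y = n).
      by exists y => z Cz fz; apply: finj; rewrite ?inE.
    by exists u => y Cy fy; case: no; exists y.
  exists (fun n => projT1 (cid (ex n))) => y Cy; exists (f y) => //.
  by case: (cid _) => x /= /(_ y Cy erefl).
(* The element [u <> 1] takes index 0 and makes the subgroup non-trivial; the enumeration of [C] is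
   shifted by one. *)
pose c' n := if n is n.+1 then c n else u.
exists (term_group c' w), val.
split; [exact: term_group_countable|exact: term_group_simple|exact: val_inj|].
move=> _ /cC[n _ <-].
have cS : c' n.+1 \in term_vals c' w by apply/term_valsP; exists (GenTree.Leaf n.+1).
by exists (Sub (c' n.+1) cS).
Qed.

(** * Soficity *)

Lemma card_moved_fix (n : nat) (s : 'S_n) : (num_fix s + #|moved s|)%N = n.
Proof.
rewrite /num_fix -[RHS]card_ord -(cardC [pred i | s i == i]); congr (_ + _)%N.
by apply: eq_card => i; rewrite !inE.
Qed.

(** * Tensor powers of permutations *)

Section PermPower.
Variables (T : finType) (r : nat).

Local Notation X := {ffun 'I_r -> T}.

Definition perm_pow_fun (s : {perm T}) (i : 'I_#|X|) : 'I_#|X| :=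
  enum_rank [ffun j => s ((enum_val i : X) j)].

Lemma perm_pow_inj s : injective (perm_pow_fun s).
Proof.
move=> i i' /enum_rank_inj/ffunP e; apply: enum_val_inj; apply/ffunP => j.
by have := e j; rewrite !ffunE => /perm_inj.
Qed.

(* The [r]-th tensor power of the permutation representation. *)
Definition perm_pow s : 'S_#|X| := perm (@perm_pow_inj s).

Lemma perm_powE s (i : 'I_#|X|) (j : 'I_r) :
  (enum_val (perm_pow s i) : X) j = s ((enum_val i : X) j).
Proof. by rewrite permE /perm_pow_fun enum_rankK ffunE. Qed.

Lemma perm_powM : {morph perm_pow : s t / s * t}.
Proof.
move=> s t; apply/permP => i; apply: enum_val_inj; apply/ffunP => j.
by rewrite permM !perm_powE permM.
Qed.

Lemma perm_pow1 : perm_pow 1 = 1.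
Proof. by apply: (mulgI (perm_pow 1)); rewrite -perm_powM !mulg1. Qed.

Lemma perm_powV s : perm_pow s^-1 = (perm_pow s)^-1.
Proof. by apply/esym/mulg1_eq; rewrite -perm_powM mulgV perm_pow1. Qed.

(** A tuple is fixed exactly when all its entries are, so the proportion of fixed points is raised
    to the power [r]. *)
Lemma num_fix_pow s : num_fix (perm_pow s) = (#|[pred x | s x == x]| ^ r)%N.
Proof.
rewrite -[in RHS](card_ord r) -card_ffun_on /num_fix.
rewrite -(card_imset _ (@enum_val_inj X predT)); apply: eq_card => f.
apply/imsetP/ffun_onP => [[i + ->] j|sf].
  by rewrite !inE => /eqP/(congr1 enum_val)/ffunP/(_ j); rewrite perm_powE => ->.
exists (enum_rank f); last by rewrite enum_rankK.
rewrite inE; apply/eqP/enum_val_inj/ffunP => j; rewrite perm_powE enum_rankK.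
by have := sf j; rewrite inE => /eqP.
Qed.

End PermPower.

Section Bernoulli.
Local Open Scope ring_scope.

Lemma bernoulli_ineq (R : realDomainType) (x : R) n : 0 <= 1 + x -> 1 + n%:R * x <= (1 + x) ^+ n.
Proof.
move=> x1; elim: n => [|n IH]; first by rewrite mul0r addr0 expr0.
rewrite exprS -natr1; have := ler_wpM2l x1 IH; have := mulr_ge0 (ler0n R n) (sqr_ge0 x).
rewrite expr2; nra.
Qed.

End Bernoulli.

Section SoficCounting.
Variables (R : realType) (G : groupType).
Local Open Scope ring_scope.

(** Amplification: [M] is fixed before the accuracy [D], so a tensor power with exponent depending
    on [M] and [eps] can be chosen first, and then [D] large enough for the multiplicative defect to
    stay small in that power. *)
Lemma sofic_of_counting :
  (forall F : {fset G}, exists M : nat, forall D : nat,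
    exists (T : finType) (phi : G -> {perm T}),
    [/\ (0 < #|T|)%N, phi 1%g = 1%g,
      forall e f, e \in F -> f \in F ->
        (D * #|moved (phi e * phi f * (phi (e * f))^-1)%g| <= #|T|)%N
    & forall e, e \in F -> e <> 1%g -> (#|T| <= M * #|moved (phi e)|)%N]) ->
  sofic R G.
Proof.
move=> H eps F eps0 eps1; have [M HM] := H F.
pose N := Num.bound eps^-1.
have N0 : 0 < N%:R :> R by apply: lt_trans (archi_boundP _); rewrite ?invr_gt0 // ltW ?invr_gt0.
have Neps : N%:R^-1 <= eps.
  by rewrite -[eps]invrK lef_pV2 ?posrE ?invr_gt0 // ltW ?archi_boundP // ltW ?invr_gt0.
(* With [1 / N <= eps], this exponent gives [(1 - 1 / M)^r <= 1 / (1 + N)], and accuracy [r * N]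
   keeps the multiplicative defect of the power at most [1 / N]. *)
pose r := (M * N)%N; have [T [phi [T0 phi1 phiM phi_free]]] := HM (r * N)%N.
exists #|{ffun 'I_r -> T}|, (fun g => perm_pow r (phi g)).
have cT : (#|{ffun 'I_r -> T}| = #|T| ^ r)%N by rewrite card_ffun card_ord.
have TR0 : 0 < #|T|%:R :> R by rewrite ltr0n.
pose fx (s : {perm T}) := #|[pred x : T | s x == x]|.
have fxE s : (fx s + #|moved s| = #|T|)%N.
  by rewrite -[RHS](cardC [pred x | s x == x]); congr (_ + _)%N; apply: eq_card => x; rewrite !inE.
have fxR (s : {perm T}) : (fx s)%:R = #|T|%:R - #|moved s|%:R :> R.
  by rewrite -(fxE s) natrD addrK.
split.
- by rewrite cT expn_gt0 T0.
- move=> e f eF fF; rewrite -perm_powM -perm_powV -perm_powM num_fix_pow -/(fx _) cT !natrX.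
  set s := (_ * _)%g; have := phiM e f eF fF; rewrite -/s => sm.
  have rN : r%:R * (#|moved s|%:R / #|T|%:R) <= N%:R^-1 :> R.
    rewrite mulrA ler_pdivrMr // ler_pdivlMl // mulrA -!natrM ler_nat.
    by rewrite [(N * r)%N]mulnC.
  rewrite -[(fx s)%:R](divfK (lt0r_neq0 TR0)) exprMn ler_wpM2r ?exprn_ge0 //.
  rewrite fxR mulrBl divff ?lt0r_neq0 //.
  apply: le_trans (bernoulli_ineq _ _); first by rewrite mulrN; lra.
  rewrite subr_ge0 ler_pdivrMr // mul1r ler_nat; have := fxE s; lia.
- by rewrite phi1 perm_pow1.
- move=> e eF e1; rewrite num_fix_pow -/(fx _) cT !natrX.
  have sm := phi_free e eF e1; set s := phi e in sm *.
  have M0 : 0 < M%:R :> R by rewrite ltr0n; case: (M) sm T0 => //; rewrite mul0n; lia.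
  rewrite -[(fx s)%:R](divfK (lt0r_neq0 TR0)) exprMn ler_wpM2r ?exprn_ge0 //.
  set b := _ / _; have b0 : 0 <= b by rewrite divr_ge0.
  have b1 : b * (1 + M%:R^-1) <= 1.
    have mT : #|moved s|%:R <= #|T|%:R :> R by rewrite ler_nat; have := fxE s; lia.
    rewrite mulrAC ler_pdivrMr // mul1r fxR mulrDr mulr1.
    have : #|T|%:R / M%:R <= #|moved s|%:R :> R by rewrite ler_pdivrMr // mulrC -natrM ler_nat.
    have : 0 <= #|moved s|%:R / M%:R :> R by rewrite divr_ge0.
    rewrite mulrBl; lra.
  (* Bernoulli's inequality bounds the other factor from below: [(1 + 1 / M)^(M * N) >= 1 + N]. *)
  have : b ^+ r * (1 + N%:R) <= 1.
    have := exprn_ile1 r (mulr_ge0 b0 _) b1; rewrite exprMn => H1.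
    apply: le_trans (H1 _); last by rewrite addr_ge0 ?invr_ge0.
    rewrite ler_wpM2l ?exprn_ge0 //.
    apply: le_trans (bernoulli_ineq _ _); last by rewrite addr_ge0 ?invr_ge0.
    by rewrite lerD2l /r natrM mulrAC mulfV ?mul1r // lt0r_neq0.
  have := exprn_ge0 r b0; move=> br0 br1; apply: le_trans Neps.
  by rewrite -[N%:R^-1]mul1r ler_pdivlMr //; lra.
Qed.

Lemma counting_of_sofic : sofic R G -> forall (F : {fset G}) (D : nat),
  exists (n : nat) (phi : G -> 'S_n),
    [/\ (0 < n)%N, phi 1%g = 1%g,
      forall e f, e \in F -> f \in F ->
        (D * #|moved (phi e * phi f * (phi (e * f))^-1)%g| <= n)%N
    & forall e, e \in F -> e <> 1%g -> (n <= 2 * #|moved (phi e)|)%N].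
Proof.
move=> sG F D; have D0 : 0 < D.+2%:R :> R by rewrite ltr0n.
(* This value is at most 1/2, so non-trivial elements of [F] move at least half of the points, and
   it is small enough for the accuracy [D]. *)
have [||n [phi [n0 phiM phi1 phi_free]]] := sG D.+2%:R^-1 F; first by rewrite invr_gt0.
  by rewrite invf_lt1 // ltr1n.
exists n, phi; split=> // [e f eF fF|e eF e1].
  have := phiM e f eF fF; set s := (_ * _)%g; have /(congr1 (fun k => k%:R : R)) := card_moved_fix s.
  rewrite natrD mulrBl mul1r => sn H1.
  have : #|moved s|%:R <= D.+2%:R^-1 * n%:R :> R.
    by move: H1; set c := (_^-1 * _); lra.
  rewrite -ler_pdivrMl ?invr_gt0 // invrK -natrM ler_nat; apply: leq_trans.
  by rewrite leq_mul2r (ltnW (leqnSn _)) orbT.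
have := phi_free e eF e1; have := card_moved_fix (phi e).
rewrite -ler_pdivrMl ?invr_gt0 // invrK -natrM ler_nat; lia.
Qed.

End SoficCounting.

Lemma gmulf1_group (G H : groupType) (f : {multiplicative G -> H}) : f 1%g = 1%g.
Proof. by apply: (mulgI (f 1%g)); rewrite -gmulfM !mulg1. Qed.

Lemma sofic_subgroup (R : realType) (G H : groupType) (f : {multiplicative G -> H}) :
  injective f -> sofic R H -> sofic R G.
Proof.
move=> f_inj sH; apply: sofic_of_counting => F; exists 2 => D.
have f1 := gmulf1_group f.
have [n [phi [n0 phi1 phiM phi_free]]] := counting_of_sofic sH [fset f x | x in F]%fset D.
exists 'I_n, (phi \o f); rewrite card_ord; split=> //=; first by rewrite f1.
  by move=> e g eF gF; rewrite gmulfM; apply: phiM; rewrite in_imfset.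
move=> e eF e1; apply: phi_free; first by rewrite in_imfset.
by rewrite -f1 => /f_inj.
Qed.

(** Only finitely many conditions on chosen lifts are involved, each valid on a large set of
    indices, so a single coordinate satisfies them all. The bound is a maximum over [F] and does not
    depend on the accuracy. *)
Lemma ultraproduct_sofic (R : realType) (I : Type) (om : set_system I) (T : I -> finType)
    (omU : UltraFilter om) :
  (forall m, om [set i | (m <= #|T i|)%N]) -> sofic R (@ultraproduct I om T omU).
Proof.
move=> T_large; apply: sofic_of_counting => F.
set U := ultraproduct T in F *; set P := prod_group (fun i => {perm T i}).
have lift_ex (a : U) : exists x : P, ultra_class x = a /\ (a = 1 -> x = 1).
  have [->|a1] := pselect (a = 1); first by exists 1; rewrite gmulf1.
  by have [x xa] := ultra_class_surj a; exists x.
pose L (a : U) := projT1 (cid (lift_ex a)).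
have LK (a : U) : ultra_class (L a) = a by exact: (projT2 (cid (lift_ex a))).1.
have L1 : L 1 = 1 by exact: (projT2 (cid (lift_ex 1))).2.
have m_ex (a : U) : exists m, a <> 1 -> om [set i | (#|T i| <= m * #|moved (L a i)|)%N].
  have [->|a1] := pselect (a = 1); first by exists 0.
  have [|m Hm] := @not_null_seq _ _ T omU (L a); last by exists m.
  by move/ultra_class_eq1; rewrite LK.
pose m (a : U) := projT1 (cid (m_ex a)).
have mP (a : U) : a <> 1 -> om [set i | (#|T i| <= m a * #|moved (L a i)|)%N].
  exact: projT2 (cid (m_ex a)).
exists (\max_(a <- F) m a) => Dn.
pose A (ef : U * U) := [set i |
  (Dn * #|moved (L ef.1 i * L ef.2 i * (L (ef.1 * ef.2) i)^-1)%g| <= #|T i|)%N].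
have omA ef : om (A ef).
  suff N : null_seq om (L ef.1 * L ef.2 * (L (ef.1 * ef.2))^-1) by exact: N.
  apply/(quot_mapP (null_seq_normal T)).
  change (ultra_class (L ef.1 * L ef.2) = ultra_class (L (ef.1 * ef.2))).
  by rewrite gmulfM /= !LK.
pose B (a : U) := [set i | a <> 1 -> (#|T i| <= m a * #|moved (L a i)|)%N].
have omB a : om (B a).
  have [->|a1] := pselect (a = 1); first by apply: filterS filterT => i _ /=.
  by apply: filterS (mP _ a1) => i Hi _.
have A_all : om (\bigcap_(ef in [set` F `*` F]%fset) A ef) by apply: filter_bigI => ef _.
have B_all : om (\bigcap_(a in [set` F]) B a) by apply: filter_bigI => a _.
have [i [[Ai Bi] T1]] := filter_ex (filterI (filterI A_all B_all) (T_large 1%N)).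
exists (T i), (fun a => L a i); split=> //; first by rewrite L1.
  by move=> e f eF fF; apply: (Ai (e, f)); rewrite /= in_fsetM eF fF.
move=> e eF e1; apply: leq_trans (Bi e eF e1) _.
by rewrite leq_mul2r (leq_bigmax_seq _ eF) ?orbT.
Qed.

(** * Permutations acting on one factor of a product *)

Section PermProduct.
Variables S T : finType.

(** A device for inflating the degree without changing the proportion of moved points. *)
Definition perm_fst_fun (s : {perm S}) (x : S * T) := (s x.1, x.2).

Lemma perm_fst_inj s : injective (perm_fst_fun s).
Proof. by move=> [x y] [x' y'] [/perm_inj -> ->]. Qed.

Definition perm_fst s : {perm S * T} := perm (@perm_fst_inj s).

Lemma perm_fstM : {morph perm_fst : s t / s * t}.
Proof. by move=> s t; apply/permP => -[x y]; rewrite permM !permE /perm_fst_fun /= permM. Qed.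

Lemma perm_fstV s : perm_fst s^-1 = (perm_fst s)^-1.
Proof.
apply/esym/mulg1_eq; rewrite -perm_fstM mulgV; apply: (mulgI (perm_fst 1)).
by rewrite -perm_fstM !mulg1.
Qed.

Lemma card_moved_fst s : #|moved (perm_fst s)| = (#|moved s| * #|T|)%N.
Proof.
rewrite -cardsT -cardsX; apply: eq_card => -[x y].
by rewrite !inE permE /perm_fst_fun xpair_eqE eqxx !andbT.
Qed.

End PermProduct.

(** Coordinate [k] is an approximation of accuracy [k] on the first [k.+1] elements of an
    enumeration, so the defects vanish along any ultrafilter containing all final segments. *)
Lemma sofic_embeds_ultraproduct (R : realType) (G : groupType) :
  countable [set: G] -> sofic R G ->
  exists (om : set_system nat) (omU : UltraFilter om) (T : nat -> finType),
    (forall m, om [set i | (m <= #|T i|)%N]) /\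
    exists f : {multiplicative G -> @ultraproduct nat om T omU}, injective f.
Proof.
move=> cG sG.
have [om [omU om_oo]] := @ultraFilterLemma _ \oo _.
have [c c_inj] := countable_injP _ cG.
have d_ex n : exists x : G, forall y, c y = n -> y = x.
  have [[y <-]|no] := pselect (exists y, c y = n).
    by exists y => z cz; apply: c_inj; rewrite ?inE.
  by exists 1 => y cy; case: no; exists y.
pose d n := projT1 (cid (d_ex n)).
have dK y : y = d (c y) by rewrite /d; case: (cid _) => x /= /(_ y erefl).
pose F k : {fset G} := [fset d (val j) | j in 'I_k.+1]%fset.
have FP y k : (c y <= k)%N -> y \in F k.
  by rewrite -ltnS => yk; rewrite [y]dK; apply/imfsetP; exists (Ordinal yk).
have ex k := counting_of_sofic sG (F k) k.
pose n k := projT1 (cid (ex k)).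
pose phi k : G -> 'S_(n k) := projT1 (cid (projT2 (cid (ex k)))).
have phiP k : [/\ (0 < n k)%N, phi k 1 = 1,
    forall e g, e \in F k -> g \in F k ->
      (k * #|moved (phi k e * phi k g * (phi k (e * g)%g)^-1)%g| <= n k)%N
  & forall e, e \in F k -> e <> 1 -> (n k <= 2 * #|moved (phi k e)|)%N].
  exact: projT2 (cid (projT2 (cid (ex k)))).
(* The factor ['I_k.+1] makes the degrees unbounded, which the approximations need not do by
   themselves. *)
pose T k : finType := ('I_(n k) * 'I_k.+1)%type.
have cT k : #|T k| = (n k * k.+1)%N by rewrite card_prod !card_ord.
have T_large m : om [set i | (m <= #|T i|)%N].
  apply: om_oo; exists m => // k /= mk; rewrite cT; have [n0 _ _ _] := phiP k.
  by apply: leq_trans (leq_pmull _ n0); rewrite (leq_trans mk).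
exists om, omU, T; split=> //.
pose f0 (g : G) : prod_group (fun k => {perm T k}) := fun k => perm_fst _ (phi k g).
pose f (g : G) := @ultra_class _ om T omU (f0 g).
have fM : {morph f : x y / x * y}.
  move=> x y; rewrite /f -gmulfM; apply/esym/quot_mapP => m.
  apply: om_oo; exists (maxn m (maxn (c x) (c y))) => // k /=.
  rewrite !geq_max => /and3P[mk /FP xk /FP yk]; have [_ _ /(_ x y xk yk) H _] := phiP k.
  rewrite -[X in moved X]/(perm_fst _ _ * perm_fst _ _ * (perm_fst _ _)^-1).
  rewrite -perm_fstV -!perm_fstM card_moved_fst cT card_ord mulnA leq_mul2r /=.
  by apply: leq_trans H; rewrite leq_mul2r mk orbT.
pose fm := isMultiplicative.Build G (@ultraproduct _ om T omU) f fM.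
exists (HB.pack_for {multiplicative G -> @ultraproduct _ om T omU} f fm) => /=.
suff f1 x : f x = 1 -> x = 1.
  move=> x y fxy; apply: divg1_eq; apply: f1.
  have := fM (x * y^-1) y; rewrite mulgVK fxy => /esym/(canRL (mulgK _)) ->.
  by rewrite mulgV.
(* At a suitable index at least half of the points move, whereas nullity with the constant 3 allows
   at most a third. *)
move/ultra_class_eq1 => /(_ 3) N3; apply: contrapT => x1.
have : om [set k | (c x <= k)%N /\ (0 < k)%N].
  by apply: om_oo; exists (c x).+1 => // k /= xk; split; lia.
move=> /(filterI N3)/filter_ex[k [/= + [/FP xk _]]].
have [n0 _ _ /(_ x xk x1)] := phiP k.
rewrite /f0 card_moved_fst cT card_ord mulnA leq_mul2r /=; move: n0 #|_|; move: (n k) => u u0 v; lia.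
Qed.

Local Close Scope group_scope.
Local Open Scope ring_scope.

(** * Amenability *)

(* The mean is transported along the coordinate [k h] of [h] in
   [h = f (k h) * r h], where [r] picks a representative in each right coset. *)
Lemma amenable_subgroup (R : realType) (G H : groupType) (f : {multiplicative G -> H}) :
  injective f -> amenable R H -> amenable R G.
Proof.
move=> f_inj [mu [mu0 mu1 muU muL]].
pose coset (h : H) : set H := [set y | exists g, h = (f g * y)%g].
(* The representative is chosen from the coset as a set, so equal cosets get the same one. *)
have ex_coset (A : set H) : exists y, forall z, A z -> A y.
  by have [[y Ay]|no] := pselect (exists y, A y); [exists y|exists 1%g => z Az; case: no; exists z].
pose r (h : H) := projT1 (cid (ex_coset (coset h))).
have coset_mul g h : coset (f g * h)%g = coset h.
  apply/seteqP; split=> y [u].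
    move=> /(congr1 (mulg (f g)^-1)%g); rewrite mulKg => ->.
    exists (g^-1 * u)%g; rewrite gmulfM mulgA; congr (_ * _ * _)%g; apply: mulg1_eq.
    by rewrite -gmulfM mulgV gmulf1_group.
  by move=> ->; exists (g * u)%g; rewrite gmulfM mulgA.
have k_ex (h : H) : exists u, h = (f u * r h)%g.
  apply: (projT2 (cid (ex_coset (coset h))) h).
  by exists 1%g; rewrite gmulf1_group mul1g.
pose k h := projT1 (cid (k_ex h)).
have kE h : h = (f (k h) * r h)%g by exact: projT2 (cid (k_ex h)).
have kM g h : k (f g * h)%g = (g * k h)%g.
  apply: f_inj; rewrite gmulfM; apply: (mulIg (r h)).
  rewrite -mulgA -kE; have <- : r (f g * h)%g = r h by rewrite /r coset_mul.
  exact/esym/kE.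
exists (fun A => mu (k @^-1` A)); split=> [A||A B AB|g A] //.
  rewrite preimage_setU muU // -preimage_setI AB preimage_set0 //.
rewrite -[RHS](muL (f g)); congr mu; apply/seteqP; split=> h /=.
  case=> x Ax xh; exists ((f g)^-1 * h)%g; last by rewrite mulVKg.
  have <- : x = k ((f g)^-1 * h)%g by apply: (mulgI g); rewrite -kM mulVKg.
  by [].
by case=> y Ay <-; rewrite /= kM; exists (k y).
Qed.

(** * Residual finiteness *)

(** The regular representation of the symmetric group on [T] turns a non-trivial image into a
    permutation without fixed points, and homomorphisms have no multiplicative defect. *)
Lemma residually_finite_sofic (R : realType) (G : groupType) :
  (forall F : {fset G}, exists (T : finType) (q : G -> {perm T}),
     {morph q : x y / (x * y)%g} /\ forall e, e \in F -> e <> 1%g -> q e <> 1%g) ->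
  sofic R G.
Proof.
move=> H; apply: sofic_of_counting => F; exists 1%N => D.
have [T [q [qM qF]]] := H F; pose reg (s : {perm T}) : {perm {perm T}} := perm (mulIg s).
have regM s t : reg (s * t)%g = (reg s * reg t)%g.
  by apply/permP => x; rewrite permM !permE mulgA.
have reg1 : reg 1%g = 1%g by apply/permP => x; rewrite permE mulg1 perm1.
have q1 : q 1%g = 1%g by apply: (mulgI (q 1%g)); rewrite -qM !mulg1.
exists {perm T}, (reg \o q); split=> /=.
- by apply/card_gt0P; exists 1%g.
- by rewrite q1.
- by move=> e f _ _; rewrite qM regM mulgV card_moved1 muln0.
- move=> e eF e1; rewrite mul1n; apply/eq_leq/esym/eq_card => x.
  by rewrite !inE permE; apply/eqP => /(canRL (mulKg x)); rewrite mulVg; exact: qF.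
Qed.

(** * The group SL(2, Z) *)

Section SL2.

Definition det2 (m : (int * int) * (int * int)) : int := m.1.1 * m.2.2 - m.1.2 * m.2.1.

(* The matrix with rows [m.1] and [m.2]. *)
Record sl2 := Sl2 { sl2_val :> (int * int) * (int * int); sl2_det : det2 sl2_val == 1 }.

HB.instance Definition _ := [isSub for sl2_val].
HB.instance Definition _ := [Countable of sl2 by <:].

Let mul_val (m n : sl2) : (int * int) * (int * int) :=
  ((m.1.1 * n.1.1 + m.1.2 * n.2.1, m.1.1 * n.1.2 + m.1.2 * n.2.2),
   (m.2.1 * n.1.1 + m.2.2 * n.2.1, m.2.1 * n.1.2 + m.2.2 * n.2.2)).

Let mul_det m n : det2 (mul_val m n) == 1.
Proof.
have /eqP := sl2_det m; have /eqP := sl2_det n; rewrite /det2 /= => dn dm.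
apply/eqP; rewrite -[RHS](mulr1 1) -{1}dm -dn; ring.
Qed.

Let inv_val (m : sl2) : (int * int) * (int * int) :=
  ((m.2.2, - m.1.2), (- m.2.1, m.1.1)).

Let inv_det m : det2 (inv_val m) == 1.
Proof. by apply/eqP; rewrite -[RHS](eqP (sl2_det m)) /det2 /=; ring. Qed.

Let mul m n := Sl2 (mul_det m n).
Let inv m := Sl2 (inv_det m).
Let one := @Sl2 ((1, 0), (0, 1)) isT.

Lemma sl2_ext (m n : sl2) : m.1.1 = n.1.1 -> m.1.2 = n.1.2 ->
  m.2.1 = n.2.1 -> m.2.2 = n.2.2 -> m = n.
Proof.
case: m n => [[[a b] [c d]] i] [[[a' b'] [c' d']] i'] /= *.
by apply: val_inj => /=; congr (_, _, (_, _)).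
Qed.

Let mulA : associative mul.
Proof. by move=> m n p; apply: sl2_ext => /=; ring. Qed.
Let one_mul : left_id one mul.
Proof. by move=> m; apply: sl2_ext => /=; ring. Qed.
Let mul_one : right_id one mul.
Proof. by move=> m; apply: sl2_ext => /=; ring. Qed.
Let inv_mul : left_inverse one inv mul.
Proof.
by move=> m; have := eqP (sl2_det m); rewrite /det2 => dm; apply: sl2_ext => /=; rewrite -?dm; ring.
Qed.
Let mul_inv : right_inverse one inv mul.
Proof.
by move=> m; have := eqP (sl2_det m); rewrite /det2 => dm; apply: sl2_ext => /=; rewrite -?dm; ring.
Qed.

HB.instance Definition _ := isGroup.Build sl2 mulA one_mul mul_one inv_mul mul_inv.

Lemma sl2_mulE (m n : sl2) : (m * n)%g = mul_val m n :> (int * int) * (int * int).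
Proof. by []. Qed.

Lemma sl2_1E : (1%g : sl2) = ((1, 0), (0, 1)) :> (int * int) * (int * int).
Proof. by []. Qed.

Section Reduction.
Variable p : nat.
Local Notation V := ('I_p.+2 * 'I_p.+2)%type.

(** Row vectors times the matrix: a right action, matching the order of composition in
    [{perm V}]. *)
Definition sl2_mod_fun (m : sl2) (v : V) : V :=
  (v.1 * m.1.1%:~R + v.2 * m.2.1%:~R, v.1 * m.1.2%:~R + v.2 * m.2.2%:~R).

Lemma sl2_mod_funM m n v : sl2_mod_fun (m * n)%g v = sl2_mod_fun n (sl2_mod_fun m v).
Proof.
rewrite /sl2_mod_fun sl2_mulE /= !rmorphD !rmorphM /=; congr (_, _); ring.
Qed.

Lemma sl2_mod_inj m : injective (sl2_mod_fun m).
Proof.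
apply: (can_inj (g := sl2_mod_fun m^-1%g)) => v.
rewrite -sl2_mod_funM mulgV /sl2_mod_fun sl2_1E /=.
by rewrite !mulr1 !mulr0 addr0 add0r; case: v.
Qed.

Definition sl2_mod m : {perm V} := perm (@sl2_mod_inj m).

Lemma sl2_modM : {morph sl2_mod : m n / (m * n)%g}.
Proof. by move=> m n; apply/permP => v; rewrite permM !permE sl2_mod_funM. Qed.

Lemma intr_Zp_eq0 (z : int) : (`|z| < p.+2)%N -> z%:~R = 0 :> 'I_p.+2 -> z = 0.
Proof.
have natr_eq0 k : (k < p.+2)%N -> k%:R = 0 :> 'I_p.+2 -> k = 0%N.
  by move=> kp /(congr1 val); rewrite /= Zp_nat /= modn_small.
case: z => k /=; first by move=> kp /(natr_eq0 _ kp) ->.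
by rewrite NegzE mulrNz => kp /eqP; rewrite oppr_eq0 => /eqP /(natr_eq0 _ kp).
Qed.

(** The basis vectors are sent to the rows of [m], and the entries of [m - 1] are too small to be
    non-zero multiples of the modulus. *)
Lemma sl2_mod_eq1 (m : sl2) : (`|m.1.1 - 1| + `|m.1.2| + `|m.2.1| + `|m.2.2 - 1| < p.+2)%N ->
  sl2_mod m = 1%g -> m = 1%g.
Proof.
move=> mp /permP m1; have := m1 (0, 1); have := m1 (1, 0).
rewrite !permE /sl2_mod_fun /= !mul0r !mul1r !addr0 !add0r => -[a1 b0] [c0 d1].
apply: sl2_ext; rewrite sl2_1E /=.
- by apply/eqP; rewrite -subr_eq0; apply/eqP/intr_Zp_eq0; [lia|rewrite rmorphB /= a1 subrr].
- by apply: intr_Zp_eq0 => //; lia.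
- by apply: intr_Zp_eq0 => //; lia.
- by apply/eqP; rewrite -subr_eq0; apply/eqP/intr_Zp_eq0; [lia|rewrite rmorphB /= d1 subrr].
Qed.

End Reduction.

Lemma sl2_sofic (R : realType) : sofic R sl2.
Proof.
apply: residually_finite_sofic => F.
pose h (m : sl2) := (`|m.1.1 - 1| + `|m.1.2| + `|m.2.1| + `|m.2.2 - 1|)%N.
exists _, (sl2_mod (\max_(m <- F) h m)); split; first exact: sl2_modM.
move=> m mF m1 qm; apply: m1; apply: sl2_mod_eq1 qm; rewrite -/(h m).
by rewrite ltnS leqW // (leq_bigmax_seq _ mF).
Qed.

(** * Non-amenability by ping-pong *)

Section NotAmenable.
Variable R : realType.

(** The translates of [S] by 1, [g] and [g * g] are disjoint and have the same mean. *)
Lemma mean_le_third (G : groupType) (mu : set G -> R) (S : set G) (g : G) :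
    (forall A, 0 <= mu A) -> mu [set: G] = 1 ->
    (forall A B, A `&` B = set0 -> mu (A `|` B) = mu A + mu B) ->
    (forall g A, mu [set (g * x)%g | x in A] = mu A) ->
  (forall x, S x -> ~ S (g * x)%g) -> (forall x, S x -> ~ S (g * (g * x))%g) ->
  mu S *+ 3 <= 1.
Proof.
move=> mu0 mu1 muU muL S1 S2.
pose gS := [set (g * x)%g | x in S]; pose ggS := [set (g * x)%g | x in gS].
have d1 : S `&` gS = set0.
  by apply/seteqP; split=> // y [] Sy [x Sx xy]; case: (S1 x Sx); rewrite xy.
have d2 : (S `|` gS) `&` ggS = set0.
  apply/seteqP; split=> // z [] Sz [y [x Sx xy] yz]; case: Sz => [Sz|[x' Sx' xz]].
    by case: (S2 x Sx); rewrite xy yz.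
  by case: (S1 x Sx); rewrite xy; have -> : y = x' by apply: (mulgI g); rewrite yz xz.
have := muU _ (~` ((S `|` gS) `|` ggS)) (setICr _).
rewrite setUv mu1 (muU _ _ d2) (muU _ _ d1) !muL.
by have := mu0 (~` ((S `|` gS) `|` ggS)); rewrite !mulrS; lra.
Qed.

(* Ping-pong on the first column [(a, c)] of a matrix: the shear
   [a := a + 3c] maps [|a| <= |c|] into [|a| > |c|]. *)
Lemma sl2_not_amenable : ~ amenable R sl2.
Proof.
move=> [mu [mu0 mu1 muU muL]].
pose S1 := [set m : sl2 | `|m.1.1| <= `|m.2.1|]; pose S2 := [set m : sl2 | `|m.2.1| <= `|m.1.1|].
pose u : sl2 := @Sl2 ((1, 3), (0, 1)) isT; pose l : sl2 := @Sl2 ((1, 0), (3, 1)) isT.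
have nz (m : sl2) : m.1.1 != 0 \/ m.2.1 != 0.
  have [m0|] := eqVneq (m.1.1) 0; last by left.
  have [m0'|] := eqVneq (m.2.1) 0; last by right.
  by have := sl2_det m; rewrite /det2 m0 m0' mul0r mulr0 subr0.
(* If [|a| <= |c|], then [c <> 0], so [|a + 3c|] and [|a + 6c|] both exceed [|c|]; the other shear
   is symmetric. *)
have third1 : mu S1 *+ 3 <= 1.
  by apply: (mean_le_third (g := u)) => // m; rewrite /S1 /= ?sl2_mulE /=; have := nz m; lia.
have third2 : mu S2 *+ 3 <= 1.
  by apply: (mean_le_third (g := l)) => // m; rewrite /S2 /= ?sl2_mulE /=; have := nz m; lia.
(* As the two sets cover the group, its mean would be at most [2 / 3]. *)
have cover : ~` S1 `<=` S2 by move=> m; rewrite /S1 /S2 /=; lia.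
have := muU _ _ (setICr S1); rewrite setUv mu1 => sum1.
have S2E : S2 = ~` S1 `|` (S2 `&` S1).
  by rewrite setUIr setvU setIT; apply/esym/setUidr.
have : mu S2 = mu (~` S1) + mu (S2 `&` S1).
  by rewrite [in LHS]S2E muU // setICA setICl setI0.
by have := mu0 (S2 `&` S1); move: third1 third2; rewrite !mulrS; lra.
Qed.

End NotAmenable.
End SL2.

(** * Simple sofic overgroups *)

Lemma sofic_embeds_simple (R : realType) (G : groupType) : countable [set: G] -> sofic R G ->
  exists (H : groupType) (f : {multiplicative G -> H}),
    [/\ countable [set: H], simple_group H, sofic R H & injective f].
Proof.
move=> cG sG; have [om [omU [T [T_large [f f_inj]]]]] := sofic_embeds_ultraproduct cG sG.
have [|||H [v [cH simH v_inj fv]]] := @countable_simple_subgroup (@ultraproduct _ om T omU) (range f).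
- exact: ultraproduct_nontrivial.
- exact: ultraproduct_conj_prod.
- exact: sub_countable (card_image_le _ _) cG.
have g_ex x : exists h, v h = f x by have [h _ hx] := fv (f x) (imageT f x); exists h.
(* The embedding into the ultraproduct factors through [v], and injectivity of [v] makes the factor
   a homomorphism. *)
pose g x := projT1 (cid (g_ex x)); have gE x : v (g x) = f x := projT2 (cid (g_ex x)).
have gM : {morph g : x y / (x * y)%g}.
  by move=> x y; apply: v_inj; rewrite gE !gmulfM !gE.
exists H, (HB.pack_for {multiplicative G -> H} g (isMultiplicative.Build G H g gM)).
split=> //; first exact: sofic_subgroup v_inj (@ultraproduct_sofic R _ om T omU T_large).
by move=> x y /(congr1 v); rewrite !gE => /f_inj.
Qed.

Theorem mainTheorem2 (R : realType) :
  (forall G : groupType, countable [set: G] -> sofic R G ->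
     exists (H : groupType) (f : {multiplicative G -> H}),
       [/\ countable [set: H], simple_group H, sofic R H & injective f])
  /\
  (exists H : groupType,
     [/\ countable [set: H], simple_group H, ~ amenable R H & sofic R H]).
Proof.
split=> [G cG sG|]; first exact: sofic_embeds_simple.
have [H [f [cH simH sH f_inj]]] := @sofic_embeds_simple R sl2 (countableP _) (@sl2_sofic R).
(* Amenability would pass from the simple overgroup down to SL(2, Z). *)
exists H; split=> // /(amenable_subgroup f_inj); exact: sl2_not_amenable.
Qed.
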